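(* Let $H$ be a connected, non-bipartite constraint graph on nodes $\{1,\dots,q\}$, let $r\ge1$, and fix a root $x$ of $\mathbb{T}^r$. Then every simple semi-invariant Gibbs measure $\mu$ on $\hom(\mathbb{T}^r,H)$ (for some activity vector) is obtained as follows: there are positive node-weights $w$ on $2H$ such that $\mu$ is the law of $|\psi|$, where $\psi$ is the random element of $\hom(\mathbb{T}^r,2H)$ produced by the $r$-branching $w$-random walk on $2H$ with the root spin $\psi(x)$ drawn from the stationary distribution of that walk restricted to the positive nodes $\{1,\dots,q\}$ and renormalized.
   Context: A constraint graph is a finite graph with loops allowed and no multiple edges; $N(i)$ is the set of nodes adjacent to $i$. The bipartite double $2H$ has nodes $\{\pm1,\dots,\pm q\}$, with $i\sim j$ in $2H$ iff $i,j$ have opposite signs and $|i|\sim|j|$ in $H$ (a loop at $i$ in $H$ becomes the edge $\{i,-i\}$). For $\psi\in\hom(\mathbb{T}^r,2H)$, $|\psi|(v)=|\psi(v)|$ defines an element of $\hom(\mathbb{T}^r,H)$. $\mathbb{T}^r$ is the infinite connected cycle-free graph with all degrees $r+1$; a site is even or odd according to the parity of its distance from $x$. A measure on $\hom(\mathbb{T}^r,H)$ is semi-invariant if $\mu(S\circ\kappa)=\mu(S)$ for every measurable $S$ and every automorphism $\kappa$ of $\mathbb{T}^r$ preserving parity, where $S\circ\kappa=\{\varphi\circ\kappa:\varphi\in S\}$. Activity vectors, Gibbs measures: for positive $\lambda$, a probability measure on $\hom(\mathbb{T}^r,H)$ is Gibbs for $\lambda$ if for every finite set $U$ of sites its conditional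 law on $U$ given the configuration off $U$ is a.s. the conditional law, given the values on $\partial U$ (the sites outside $U$ adjacent to $U$), under the measure on $\hom(U\cup\partial U,H)$ with weights $\prod_v\lambda_{\varphi(v)}$. A Gibbs measure on a tree is simple if, for every site $u$ and spin $i$, the restrictions of $\varphi$ to the components of $\mathbb{T}^r\setminus\{u\}$ are mutually independent given $\varphi(u)=i$. The $r$-branching $w$-random walk on a graph $K$ with positive node weights $w$: with $z_i=\sum_{j\in N(i)}w_j$, each child of a site with spin $i$ receives spin $j\in N(i)$ with probability $w_j/z_i$, independently given the parent's spin; its stationary distribution is $\pi_i\propto w_iz_i$. *)

(* Defs.v *)
From HB Require Import structures.
From mathcomp Require Import all_boot all_order all_algebra.
From mathcomp Require Import all_classical all_reals all_analysis.
Set Implicit Arguments.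
Unset Strict Implicit.
Unset Printing Implicit Defensive.
Import Order.TTheory GRing.Theory Num.Theory.
Local Open Scope classical_set_scope.

(* The (r+1)-regular tree T^r, rooted at x := None.                    *)
(* A non-root site is Some (a, s): first step a : 'I_(r+1) from the     *)
(* root, then successive child choices s (each child of a non-root     *)
(* site is indexed by 'I_r).                                           *)
Definition site (r : nat) : Type := option ('I_r.+1 * seq 'I_r).

Definition root {r : nat} : site r := None.

Definition depth {r : nat} (v : site r) : nat :=
  match v with None => 0 | Some (_, s) => (size s).+1 end.

Definition parent {r : nat} (v : site r) : option (site r) :=
  match v with
  | None => None
  | Some (a, s) => if s is [::] then Some None
                   else Some (Some (a, take (size s).-1 s))
  end.

Definition children {r : nat} (v : site r) : seq (site r) :=
  match v with
  | None => [seq Some (a, [::]) | a <- enum 'I_r.+1]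
  | Some (a, s) => [seq Some (a, rcons s b) | b <- enum 'I_r]
  end.

Definition tadj {r : nat} (u v : site r) : bool :=
  (parent v == Some u) || (parent u == Some v).

Definition nbrs {r : nat} (u : site r) : seq (site r) :=
  (if parent u is Some p then [:: p] else [::]) ++ children u.

Definition anc {r : nat} (w : site r) : seq (site r) :=
  match w with
  | None => [:: None]
  | Some (a, s) => None :: [seq Some (a, take k s) | k <- iota 0 (size s).+1]
  end.

Definition desc {r : nat} (v w : site r) : bool := v \in anc w.

(* For a neighbour n of u, comp u n is the connected component of
   T^r \ {u} containing n. *)
Definition comp {r : nat} (u n : site r) : pred (site r) :=
  fun v => if parent u == Some n then ~~ desc u v else desc n v.

Definition tree_aut {r : nat} (k : site r -> site r) : Prop :=
  bijective k /\ forall u v, tadj (k u) (k v) = tadj u v.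

Definition parity_preserving {r : nat} (k : site r -> site r) : Prop :=
  forall v, odd (depth (k v)) = odd (depth v).

Definition connected_graph {V : finType} (adj : rel V) : Prop :=
  forall i j, connect adj i j.

Definition bipartite_graph {V : finType} (adj : rel V) : Prop :=
  exists c : V -> bool, forall i j, adj i j -> c i != c j.

(* node (i, true) of 2H is +i, node (i, false) is -i *)
Definition dnode (q : nat) : finType := ('I_q.+1 * bool)%type.

Definition dadj {q : nat} (adj : rel 'I_q.+1) : rel (dnode q) :=
  fun a b => (a.2 != b.2) && adj a.1 b.1.

Definition is_hom {r : nat} {V : Type} (adj : rel V) (phi : site r -> V) : Prop :=
  forall u v, tadj u v -> adj (phi u) (phi v).

Definition hcfg (r q : nat) := site r -> 'I_q.+1.
HB.instance Definition _ r q := gen_eqMixin (hcfg r q).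
HB.instance Definition _ r q := gen_choiceMixin (hcfg r q).
HB.instance Definition _ r q := isPointed.Build (hcfg r q) (fun _ => ord0).

Definition dcfg (r q : nat) := site r -> dnode q.
HB.instance Definition _ r q := gen_eqMixin (dcfg r q).
HB.instance Definition _ r q := gen_choiceMixin (dcfg r q).
HB.instance Definition _ r q := isPointed.Build (dcfg r q) (fun _ => (ord0, true)).

Definition cylinders {T V : Type} : set (set (T -> V)) :=
  [set A | exists (v : T) (a : V), A = [set phi : T -> V | phi v = a]].

Definition hspace (r q : nat) := @g_sigma_algebraType (hcfg r q) cylinders.
Definition dspace (r q : nat) := @g_sigma_algebraType (dcfg r q) cylinders.

Definition determined_by {T V : Type} (C : pred T) (B : set (T -> V)) : Prop :=
  forall phi phi', (forall v, C v -> phi v = phi' v) -> B phi -> B phi'.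

Local Open Scope ring_scope.

Section Gibbs.
Variables (R : realType) (r q : nat) (adj : rel 'I_q.+1) (lam : 'I_q.+1 -> R).

Definition ext (U : seq (site r)) (s : seq 'I_q.+1) (phi : site r -> 'I_q.+1) :
    site r -> 'I_q.+1 :=
  fun v => if v \in U then nth (phi v) s (index v U) else phi v.

Definition Ubar (U : seq (site r)) : seq (site r) :=
  undup (U ++ flatten [seq nbrs u | u <- U]).

Definition okU (U : seq (site r)) (s : seq 'I_q.+1) (phi : site r -> 'I_q.+1) : bool :=
  all (fun u => all (fun v => tadj u v ==> adj (ext U s phi u) (ext U s phi v))
                    (Ubar U)) (Ubar U).

Definition weightU (U : seq (site r)) (s : seq 'I_q.+1) (phi : site r -> 'I_q.+1) : R :=
  (okU U s phi)%:R * \prod_(v <- Ubar U) lam (ext U s phi v).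

Definition gibbs_kernel (U : seq (site r)) (t : (size U).-tuple 'I_q.+1)
    (phi : site r -> 'I_q.+1) : R :=
  weightU U t phi / \sum_(t' : (size U).-tuple 'I_q.+1) weightU U t' phi.

(* mu is a Gibbs measure for lam on hom(T^r, H): it is carried by
   hom(T^r,H), and for every finite U the conditional law on U given
   the sigma-algebra of events depending only on the sites outside U is
   (a.s.) the Gibbs kernel. *)
Definition is_gibbs (mu : probability (hspace r q) R) : Prop :=
  mu [set phi | is_hom adj phi] = 1%E /\
  forall (U : seq (site r)), uniq U ->
  forall (t : (size U).-tuple 'I_q.+1) (B : set (hspace r q)),
    measurable B -> determined_by (fun v => v \notin U) B ->
    mu ([set phi | forall v, v \in U -> phi v = nth (phi v) t (index v U)] `&` B)
    = (\int[mu]_(phi in B) (gibbs_kernel t phi)%:E)%E.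

End Gibbs.

Definition semi_invariant {R : realType} {r q : nat} (mu : probability (hspace r q) R) : Prop :=
  forall k : site r -> site r, tree_aut k -> parity_preserving k ->
  forall S : set (hspace r q), measurable S ->
    mu [set (phi \o k : hspace r q) | phi in S] = mu S.

Definition condP {R : realType} {d} {T : measurableType d} (mu : probability T R)
    (E A : set T) : R :=
  fine (mu (A `&` E)) / fine (mu E).

Definition simple_measure {R : realType} {r q : nat} (mu : probability (hspace r q) R) : Prop :=
  forall (u : site r) (i : 'I_q.+1),
    let E := [set phi : hspace r q | phi u = i] in
    (0 < mu E)%E ->
    forall A : site r -> set (hspace r q),
      (forall n, n \in nbrs u -> measurable (A n) /\ determined_by (comp u n) (A n)) ->
      condP mu E [set phi | forall n, n \in nbrs u -> A n phi]
      = \prod_(n <- nbrs u) condP mu E (A n).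

Section Walk.
Variables (R : realType) (r q : nat) (adj : rel 'I_q.+1) (w : dnode q -> R).

Definition zw (a : dnode q) : R := \sum_(b | dadj adj a b) w b.

Definition trans (a b : dnode q) : R := (dadj adj a b)%:R * w b / zw a.

(* stationary distribution pi_a ~ w_a z_a restricted to the positive
   nodes and renormalized *)
Definition root_law (a : dnode q) : R :=
  if a.2 then w a * zw a / \sum_(c : dnode q | c.2) (w c * zw c) else 0.

Fixpoint tw (psi0 : site r -> dnode q) (n : nat) (v : site r) : R :=
  match n with
  | 0 => 1
  | k.+1 => \prod_(c <- children v) (trans (psi0 v) (psi0 c) * tw psi0 k c)
  end.

Definition walk_law (P : probability (dspace r q) R) : Prop :=
  forall (n : nat) (psi0 : site r -> dnode q),
    P [set psi | forall v, (depth v <= n)%N -> psi v = psi0 v]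
    = (root_law (psi0 root) * tw psi0 n root)%:E.

End Walk.

Definition absmap {r q : nat} (psi : dspace r q) : hspace r q :=
  fun v => (psi v).1.

(* Main.v *)
(* A lift of a configuration of H to 2H that is positive at the root must have
   the sign of the parity of the depth, so the law of psi is the image of mu
   under phi |-> (phi, parity), and it is enough to see that mu is a Markov
   chain on the tree with the right transition probabilities.
   Semi-invariance makes the joint law E i j of the spins on an edge (i at the
   even end, j at the odd end) the same for all edges, and simplicity gives the
   Markov property.  If a i is the law of an even spin, simplicity and the Gibbs
   condition at an even site with all r+1 neighbours of spin j give
     a i * (E i j / a i)^(r+1) = [i ~ j] * lam i * C j,
   and similarly at odd sites.  As 2H is connected, these make E i j positive for
   all i ~ j, and then E i j = w(i) w(-j) with
   w(i)^(r+1) = lam i * (a i)^r and w(-j)^(r+1) = C j. *)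
Require Import Defs.
From HB Require Import structures.
From mathcomp Require Import all_boot all_order all_algebra perm ring.
From mathcomp Require Import all_classical all_reals all_analysis.
Set Implicit Arguments.
Unset Strict Implicit.
Unset Printing Implicit Defensive.
Import Order.TTheory GRing.Theory Num.Theory.
Local Open Scope ring_scope.
Local Open Scope classical_set_scope.

(** * Adjacency, parity and automorphisms of the tree *)

Section Tree.
Variable r : nat.
Implicit Types u v n : site r.

Lemma tadj_sym u v : tadj u v = tadj v u.
Proof. by rewrite /tadj orbC. Qed.

Lemma parent_children u v : (parent v == Some u) = (v \in children u).
Proof.
apply/eqP/idP; case: v => [[a s]|] //=.
- case: s => [|b s] /=.
    by move=> [<-] /=; apply/mapP; exists a; rewrite ?mem_enum.
  move=> [<-]; rewrite -(size_belast b s) lastI -cats1 take_size_cat // cats1.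
  by apply/mapP; exists (last b s); rewrite ?mem_enum.
- case: u => [[a' s']|] /= /mapP[b _] [-> ->] //.
  case E : (rcons s' b) => [|c t]; first by case: s' E.
  by rewrite -E size_rcons /= -cats1 take_size_cat.
- by case: u => [[a' s']|] /= /mapP[b _].
Qed.

Lemma mem_nbrs u v : (v \in nbrs u) = tadj u v.
Proof.
rewrite /tadj mem_cat parent_children orbC; congr (_ || _).
by case: (parent u) => //= p; rewrite inE eq_sym.
Qed.

Lemma depth_parent u v : parent v = Some u -> depth v = (depth u).+1.
Proof.
by move/eqP; rewrite parent_children; case: u => [[a s]|] /= /mapP[b _ ->] //=;
  rewrite size_rcons.
Qed.

Lemma parity_adj u v : tadj u v -> odd (depth v) = ~~ odd (depth u).
Proof.
by case/orP => /eqP/depth_parent -> //=; rewrite negbK.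
Qed.

Lemma size_nbrs u : size (nbrs u) = r.+1.
Proof.
rewrite size_cat; case: u => [[a s]|] /=; last by rewrite size_map size_enum_ord.
by rewrite size_map size_enum_ord; case: s.
Qed.

Lemma nbrs_ex u : exists n, n \in nbrs u.
Proof. by case: (nbrs u) (size_nbrs u) => [//|n s] _; exists n; rewrite mem_head. Qed.

(* The reflection of the tree in the edge between the root and child 0. *)
Definition flip v : site r :=
  match v with
  | None => Some (ord0, [::])
  | Some (a, s) =>
      match unlift ord0 a with
      | None => if s is b :: s' then Some (lift ord0 b, s') else None
      | Some b => Some (ord0, b :: s)
      end
  end.

Lemma flip0 s : flip (Some (ord0, s)) =
  if s is b :: s' then Some (lift ord0 b, s') else None.
Proof. by rewrite /= unlift_none. Qed.

Lemma flipS (b : 'I_r) s : flip (Some (lift ord0 b, s)) = Some (ord0, b :: s).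
Proof. by rewrite /= liftK. Qed.

Lemma flipK : involutive flip.
Proof.
case=> [[a s]|]; last by rewrite flip0.
case: (unliftP ord0 a) => [b|] ->; first by rewrite flipS flip0.
by rewrite flip0; case: s => [|b s] //; rewrite flipS.
Qed.

(** It is enough that a parent and its child go to adjacent sites; the converse follows because
    [flip] is an involution. *)
Lemma flip_adj u v : tadj (flip u) (flip v) = tadj u v.
Proof.
have child u1 v1 : v1 \in children u1 -> tadj (flip u1) (flip v1).
  case: u1 => [[a s]|] /= /mapP[b _ ->].
    case: (unliftP ord0 a) => [c|] ->.
      rewrite !flipS tadj_sym /tadj !parent_children; apply/orP; right=> /=.
      by apply/mapP; exists b; rewrite ?mem_enum.
    rewrite !flip0; case: s => [|c s] /=.
      by rewrite /tadj !parent_children /=; apply/orP; left; apply/mapP;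
        exists (lift ord0 b); rewrite ?mem_enum.
    by rewrite /tadj !parent_children /=; apply/orP; left; apply/mapP;
        exists b; rewrite ?mem_enum.
  rewrite -/(flip None) -/(flip (Some (b, [::]))).
  case: (unliftP ord0 b) => [c|] ->; rewrite ?flipS ?flip0 /=.
    rewrite /tadj !parent_children /=; apply/orP; left.
    by apply/mapP; exists c; rewrite ?mem_enum.
  by rewrite /tadj /= eqxx.
have imp u1 v1 : tadj u1 v1 -> tadj (flip u1) (flip v1).
  by rewrite {1}/tadj !parent_children => /orP[]/child //; rewrite tadj_sym.
by apply/idP/idP => /imp //; rewrite !flipK.
Qed.

Lemma flip_parity v : odd (depth (flip v)) = ~~ odd (depth v).
Proof.
case: v => [[a s]|] //; case: (unliftP ord0 a) => [c|] ->; rewrite ?flipS ?flip0 //=.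
by case: s => //= b s; rewrite negbK.
Qed.

(** Together with [flip], these depth-preserving exchanges of two branches at the root suffice to
    carry any site to the root. *)
Definition root_swap (a : 'I_r.+1) v : site r :=
  if v is Some (b, s) then Some (tperm ord0 a b, s) else None.

Lemma root_swapK a : involutive (root_swap a).
Proof. by case=> [[b s]|] //=; rewrite tpermK. Qed.

Lemma root_swap_parent a v : parent (root_swap a v) = omap (root_swap a) (parent v).
Proof. by case: v => [[b [|c s]]|]. Qed.

Lemma root_swap_adj a u v : tadj (root_swap a u) (root_swap a v) = tadj u v.
Proof.
by rewrite /tadj !root_swap_parent;
  congr (_ || _); rewrite -[RHS](inj_eq (inj_omap (inv_inj (root_swapK a)))).
Qed.

Lemma root_swap_depth a v : depth (root_swap a v) = depth v.
Proof. by case: v => [[b s]|]. Qed.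

Lemma tree_aut_comp (k1 k2 : site r -> site r) :
  tree_aut k1 -> tree_aut k2 -> tree_aut (k1 \o k2).
Proof.
move=> [b1 a1] [b2 a2]; split; first exact: bij_comp.
by move=> u v /=; rewrite a1 a2.
Qed.

Lemma flip_aut : tree_aut flip.
Proof. by split; [exact: inv_bij flipK | exact: flip_adj]. Qed.

Lemma root_swap_aut a : tree_aut (root_swap a).
Proof. by split; [exact: inv_bij (root_swapK a) | exact: root_swap_adj]. Qed.

(** Induction on the address of [u]: [root_swap] brings its branch to child 0, and [flip] then
    shortens the address by one step. Each [flip] reverses all parities, so the total change is the
    parity of [depth u]. *)
Lemma aut_to_root u : exists2 k : site r -> site r, tree_aut k &
  k u = Defs.root /\ forall v, odd (depth (k v)) = odd (depth u) (+) odd (depth v).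
Proof.
case: u => [[a s]|]; last first.
  exists id; first by split; [exact: inv_bij | ].
  by split => // v; rewrite addFb.
elim: s a => [|b s IHs] a.
  exists (flip \o root_swap a); first exact: tree_aut_comp flip_aut (root_swap_aut a).
  split=> [|v]; first by rewrite /= tpermR unlift_none.
  by rewrite /= flip_parity root_swap_depth.
have [k kaut [kb kpar]] := IHs (lift ord0 b).
exists (k \o (flip \o root_swap a)).
  exact: tree_aut_comp kaut (tree_aut_comp flip_aut (root_swap_aut a)).
split=> [|v]; first by rewrite /= tpermR unlift_none.
by rewrite /= kpar flip_parity root_swap_depth /= !addNb addbN.
Qed.

Definition fst_child : site r := Some (ord0, [::]).

(** For an even [u] the map of [aut_to_root] preserves parity, and a last swap at the root brings
    the image of [v] to child 0. Hence parity-preserving automorphisms act transitively on edges. *)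
Lemma aut_to_root_edge u v : ~~ odd (depth u) -> tadj u v ->
  exists2 k : site r -> site r, tree_aut k &
    [/\ parity_preserving k, k u = Defs.root & k v = fst_child].
Proof.
move=> eu uv; have [k kaut [ku kpar]] := aut_to_root u.
have : tadj Defs.root (k v) by rewrite -ku kaut.2.
rewrite /tadj orbF parent_children => /mapP[a _ kv].
exists (root_swap a \o k); first exact: tree_aut_comp (root_swap_aut a) kaut.
split=> [x||]; rewrite /= ?kv ?ku //=; last by rewrite tpermR.
by rewrite root_swap_depth kpar (negbTE eu).
Qed.

End Tree.

(** * Descendants, and the components left by removing a site *)

Section Descendants.
Variable r : nat.
Implicit Types u v c x : site r.

Lemma descP a s x :
  reflect (exists t, x = Some (a, s ++ t)) (desc (Some (a, s)) x).
Proof.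
have memE b t : desc (Some (a, s)) (Some (b, t)) =
    (Some (a, s) \in [seq Some (b, take k t) | k <- iota 0 (size t).+1]).
  by rewrite /desc in_cons.
apply: (iffP idP) => [|[t ->]].
  case: x => [[b t]|] //; rewrite memE => /mapP[k _ [-> ->]].
  by exists (drop k t); rewrite cat_take_drop.
rewrite memE; apply/mapP; exists (size s); last by rewrite take_size_cat.
by rewrite mem_iota add0n ltnS size_cat leq_addr.
Qed.

Lemma desc_refl v : desc v v.
Proof. by case: v => [[a s]|] //; apply/descP; exists [::]; rewrite cats0. Qed.

Lemma desc_root x : desc Defs.root x.
Proof. by case: x => [[a s]|]; rewrite /desc in_cons eqxx. Qed.

Lemma descE v x :
  reflect (x = v \/ exists2 c, c \in children v & desc c x) (desc v x).
Proof.
apply: (iffP idP); case: v => [[a s]|].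
- case/descP=> [[|b t]] ->; first by left; rewrite cats0.
  right; exists (Some (a, rcons s b)); first by rewrite map_f ?mem_enum.
  by apply/descP; exists t; rewrite cat_rcons.
- case: x => [[a s]|] _; [right|by left].
  exists (Some (a, [::])); first by rewrite map_f ?mem_enum.
  by apply/descP; exists s.
- move=> [->|[c /mapP[b _ ->] /descP[t ->]]]; first exact: desc_refl.
  by apply/descP; exists (b :: t); rewrite cat_rcons.
- by move=> _; exact: desc_root.
Qed.

Lemma desc_depth v x : desc v x -> (depth v <= depth x)%N.
Proof.
by case: v => [[a s]|] // /descP[t ->]; rewrite /= size_cat ltnS leq_addr.
Qed.

Lemma depth_child u c : c \in children u -> depth c = (depth u).+1.
Proof. by rewrite -parent_children => /eqP/depth_parent. Qed.

Lemma children_inj u v c : c \in children u -> c \in children v -> v = u.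
Proof. by rewrite -!parent_children => /eqP -> /eqP[]. Qed.

Lemma comp_child u c x : c \in children u -> Defs.comp u c x = desc c x.
Proof.
move=> uc; rewrite /Defs.comp; case: eqP => // /depth_parent du.
by have := depth_child uc; rewrite du => /eqP; rewrite -[X in X == _]addn0 -addn2
  eqn_add2l.
Qed.

Lemma comp_parent u c : c \in children u -> Defs.comp c u u.
Proof.
move=> uc; rewrite /Defs.comp parent_children uc; apply/negP => /desc_depth.
by rewrite (depth_child uc) ltnn.
Qed.

Lemma comp_nbr u n : n \in nbrs u -> Defs.comp u n n.
Proof.
rewrite mem_nbrs /tadj !parent_children => /orP[un|]; last exact: comp_parent.
by rewrite comp_child ?desc_refl.
Qed.

Lemma nbrs_neq u n : n \in nbrs u -> n != u.
Proof.
by rewrite mem_nbrs => /parity_adj h; apply: contra_eqN h => /eqP ->; case: odd.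
Qed.

End Descendants.

(** * Cylinder events and the lift of a configuration by parity *)

Section Events.
Variables (r q : nat).
Implicit Types (u v n c : site r) (i j : 'I_q.+1) (phi : hspace r q).

Definition site_is v i : set (hspace r q) := [set phi | phi v = i].

Lemma measurable_site_is v i : measurable (site_is v i).
Proof. by apply: sub_sigma_algebra; exists v, i. Qed.

Lemma measurable_forall_in (I : eqType) (s : seq I) (A : I -> set (hspace r q)) :
  (forall x, x \in s -> measurable (A x)) ->
  measurable [set phi | forall x, x \in s -> A x phi].
Proof.
elim: s => [|y s IHs] mA.
  by rewrite (_ : [set _ | _] = setT) //; apply/seteqP; split.
rewrite (_ : [set _ | _] = A y `&` [set phi | forall x, x \in s -> A x phi]).
  apply: measurableI; first by apply: mA; rewrite mem_head.
  by apply: IHs => x xs; apply: mA; rewrite in_cons xs orbT.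
apply/seteqP; split=> phi /=.
  by move=> h; split=> [|x xs]; apply: h; rewrite in_cons ?eqxx // xs orbT.
by move=> [hy hs] x; rewrite in_cons => /orP[/eqP ->|/hs].
Qed.

Definition nbrs_are u j : set (hspace r q) :=
  [set phi | forall n, n \in nbrs u -> phi n = j].

Lemma measurable_nbrs_are u j : measurable (nbrs_are u j).
Proof. by apply: measurable_forall_in => n _; exact: measurable_site_is. Qed.

Definition parity_lift phi : dspace r q := fun v => (phi v, ~~ odd (depth v)).

(** Built by the same recursion as [tw], so that one induction compares the two; [ball_eventP]
    identifies it with a cylinder on the first [k] generations below [v]. *)
Fixpoint ball_event (psi0 : site r -> dnode q) (k : nat) v : set (hspace r q) :=
  if k is k'.+1 then
    [set phi | forall c, c \in children v -> ball_event psi0 k' c phi]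
      `&` [set phi | parity_lift phi v = psi0 v]
  else [set phi | parity_lift phi v = psi0 v].

Lemma ball_eventP psi0 k v phi :
  ball_event psi0 k v phi <->
  forall x, desc v x -> (depth x <= k + depth v)%N -> parity_lift phi x = psi0 x.
Proof.
elim: k v => [|k IHk] v /=; split.
- move=> h x /descE[->//|[c /depth_child cv /desc_depth]].
  by rewrite cv add0n => xv /(leq_trans xv); rewrite ltnn.
- by move=> h; apply: h; rewrite ?desc_refl.
- move=> [h1 h2] x /descE[->//|[c vc cx]] xk.
  by apply: (proj1 (IHk c) (h1 c vc)) => //; rewrite (depth_child vc) addnS -addSn.
- move=> h; split; last by apply: h; rewrite ?desc_refl ?leq_addl.
  move=> c vc; apply/IHk => x cx; rewrite (depth_child vc) addnS -addSn => xk.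
  by apply: h => //; apply/descE; right; exists c.
Qed.

Lemma ball_event_lift psi0 k v :
  ball_event psi0 k v `<=` [set phi | parity_lift phi v = psi0 v].
Proof. by case: k => [|k] phi //= []. Qed.

Lemma ball_event_wrong_sign psi0 k v :
  (psi0 v).2 != ~~ odd (depth v) -> ball_event psi0 k v = set0.
Proof.
move=> sv; apply/seteqP; split=> // phi /ball_event_lift /= h.
by move: sv; rewrite -h eqxx.
Qed.

Lemma lift_site_is psi0 v : (psi0 v).2 = ~~ odd (depth v) ->
  [set phi | parity_lift phi v = psi0 v] = site_is v (psi0 v).1.
Proof.
rewrite /parity_lift /site_is; case: (psi0 v) => a b /= ->.
by apply/seteqP; split=> phi /=; [case | move=> ->].
Qed.

Lemma measurable_lift_site v (a : dnode q) :
  measurable ([set phi | parity_lift phi v = a] : set (hspace r q)).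
Proof.
have [sv|sv] := eqVneq a.2 (~~ odd (depth v)).
  by rewrite (@lift_site_is (fun=> a)) //; exact: measurable_site_is.
by rewrite (_ : [set _ | _] = set0) //; apply/seteqP; split=> // phi /= h;
  move: sv; rewrite -h eqxx.
Qed.

Lemma measurable_ball_event psi0 k v : measurable (ball_event psi0 k v).
Proof.
elim: k v => [|k IHk] v /=; first exact: measurable_lift_site.
by apply: measurableI; [exact: measurable_forall_in|exact: measurable_lift_site].
Qed.

Lemma ball_event_determined psi0 k v :
  determined_by (desc v) (ball_event psi0 k v).
Proof.
move=> phi phi' h /ball_eventP H; apply/ball_eventP => x vx /(H x vx) <-.
by rewrite /parity_lift h.
Qed.

Lemma site_is_determined (C : pred (site r)) v i :
  C v -> determined_by C (site_is v i).
Proof. by move=> Cv phi phi' h <-; rewrite /site_is /= h. Qed.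

End Events.

(** * Probabilities of events as real numbers *)

Section Law.
Variables (R : realType) (r q : nat) (mu : probability (hspace r q) R).
Implicit Types (u v n c : site r) (i j : 'I_q.+1) (A B : set (hspace r q)).

Definition prob A : R := fine (mu A).

Lemma probE A : measurable A -> mu A = (prob A)%:E.
Proof. by move=> mA; rewrite /prob fineK // fin_num_measure. Qed.

Lemma prob_ge0 A : 0 <= prob A.
Proof. by rewrite fine_ge0. Qed.

Lemma prob0 : prob set0 = 0.
Proof. by rewrite /prob measure0. Qed.

Lemma probT : prob setT = 1.
Proof. by rewrite /prob probability_setT. Qed.

Lemma le_prob A B : measurable A -> measurable B -> A `<=` B -> prob A <= prob B.
Proof.
move=> mA mB AB; rewrite -lee_fin -!probE //.
by apply: le_measure => //; rewrite inE.
Qed.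

Lemma prob_marginal v A : measurable A ->
  prob A = \sum_j prob (site_is v j `&` A).
Proof.
move=> mA; have mS j : measurable (site_is v j `&` A).
  by apply: measurableI => //; exact: measurable_site_is.
rewrite /prob sum_fine; last by move=> j _; rewrite fin_num_measure.
rewrite -measure_bigsetU_ord //; last first.
  by move=> j k _ _ [phi [[<- _] [<- _]]].
congr (fine (mu _)); rewrite -bigcup_seq; apply/seteqP; split=> phi /=.
  by move=> Aphi; exists (phi v) => //=; rewrite mem_index_enum.
by move=> [j _ []].
Qed.

(** * The Markov property from simplicity *)

Section Simple.
Hypothesis mu_simple : simple_measure mu.

(** Simplicity with the conditional probabilities multiplied out; for a spin of probability zero
    both sides vanish. *)
Lemma prob_star u i (A : site r -> set (hspace r q)) :
  (forall n, n \in nbrs u -> measurable (A n) /\ determined_by (Defs.comp u n) (A n)) ->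
  prob ([set phi | forall n, n \in nbrs u -> A n phi] `&` site_is u i) =
  prob (site_is u i) *
    \prod_(n <- nbrs u) (prob (A n `&` site_is u i) / prob (site_is u i)).
Proof.
move=> hA; have mE := measurable_site_is u i.
have mAll : measurable [set phi | forall n, n \in nbrs u -> A n phi].
  by apply: measurable_forall_in => n /hA[].
have [E0|E0] := eqVneq (prob (site_is u i)) 0.
  rewrite E0 mul0r; apply/eqP; rewrite eq_le prob_ge0 andbT -E0.
  by apply: le_prob => [||? []]; first exact: measurableI.
have Epos : (0 < mu (site_is u i))%E.
  by rewrite probE // lte_fin lt_def E0 prob_ge0.
have := mu_simple Epos hA; rewrite /condP -!/(prob _) => <-.
by rewrite mulrC divfK.
Qed.

Hypothesis prob_pos : forall u i, 0 < prob (site_is u i).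

Let prob_neq0 u i : prob (site_is u i) != 0.
Proof. exact: lt0r_neq0. Qed.

Lemma prod_nbrs_child u c (F : site r -> R) : c \in children u ->
  \prod_(n <- nbrs c) F n = F u * \prod_(n <- children c) F n.
Proof. by rewrite -parent_children /nbrs => /eqP ->; rewrite /= big_cons. Qed.

(* The Markov property on the edge uc: by simplicity at c, what happens above c
   is independent of the ball below c, given the spin of c. *)
Lemma prob_child_ball psi0 k u c i : c \in children u ->
  (psi0 c).2 = ~~ odd (depth c) ->
  let j := (psi0 c).1 in
  prob (ball_event psi0 k c `&` site_is u i) =
  prob (site_is c j `&` site_is u i) / prob (site_is c j) * prob (ball_event psi0 k c).
Proof.
move=> uc sc j; case: k => [|k] /=; rewrite lift_site_is //.
  by rewrite divfK.
(* Simplicity at [c] is applied with [B] on the component of the parent and the balls on those of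
   the children. Comparing [B := site_is u i] with [B := setT] eliminates the product over the
   children. *)
pose A B x := if x == u then B else ball_event psi0 k x.
have cu x : x \in children c -> x != u.
  move=> /depth_child; rewrite (depth_child uc) => h.
  by apply: contra_eqN h => /eqP ->; rewrite -addn2 -{1}[depth u]addn0 eqn_add2l.
have starE B :
    [set phi | forall n, n \in nbrs c -> A B n phi] =
    [set phi | forall x, x \in children c -> ball_event psi0 k x phi] `&` B.
  apply/seteqP; split=> phi /= h.
    split=> [x xc|].
      by have := h x; rewrite mem_cat xc orbT /A (negbTE (cu _ xc)); apply.
    by have := h u; rewrite mem_nbrs /tadj !parent_children uc orbT /A eqxx; apply.
  move=> x; rewrite mem_nbrs /tadj !parent_children => /orP[xc|].
    by rewrite /A (negbTE (cu _ xc)); apply: h.1.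
  by move/(children_inj uc) => ->; rewrite /A eqxx; exact: h.2.
have star B : measurable B -> determined_by (Defs.comp c u) B ->
    prob ([set phi | forall x, x \in children c -> ball_event psi0 k x phi] `&` B
          `&` site_is c j) =
    prob (B `&` site_is c j) * \prod_(x <- children c)
      (prob (ball_event psi0 k x `&` site_is c j) / prob (site_is c j)).
  move=> mB dB; rewrite -starE prob_star.
    rewrite (prod_nbrs_child _ uc) mulrA /A eqxx mulrCA divff // mulr1.
    by congr (_ * _); apply: eq_big_seq => x /cu /negbTE ->.
  move=> x; rewrite /A; case: eqVneq => [-> _//|/negP xu].
  rewrite mem_nbrs /tadj !parent_children => /orP[xc|xc].
    split; first exact: measurable_ball_event.
    by move=> phi phi' h; apply: ball_event_determined => y;
      rewrite -(comp_child y xc); apply: h.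
  by case: xu; apply/eqP; exact: children_inj uc xc.
rewrite setIAC star; last 2 first.
- exact: measurable_site_is.
- by apply: site_is_determined; exact: comp_parent.
have := star setT; rewrite setIT setTI => ->//.
by rewrite mulrA divfK // setIC.
Qed.

(** Induction on the radius: simplicity at [v] factors the event over the children, and the Markov
    property turns each factor into a transition probability times the [tw] of the smaller ball. *)
Lemma prob_ball (adj : rel 'I_q.+1) (w : dnode q -> R) psi0 k v :
  (forall u c i j, c \in children u ->
     trans adj w (i, ~~ odd (depth u)) (j, ~~ odd (depth c)) =
     prob (site_is c j `&` site_is u i) / prob (site_is u i)) ->
  (psi0 v).2 = ~~ odd (depth v) ->
  prob (ball_event psi0 k v) = prob (site_is v (psi0 v).1) * tw adj w psi0 k v.
Proof.
move=> transE; elim: k v => [|k IHk] v sv /=; rewrite lift_site_is ?mulr1 //.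
(* The component of the parent, if there is one, carries no condition and contributes a factor 1. *)
pose A x := if x \in children v then ball_event psi0 k x else setT.
have AE : [set phi | forall n, n \in nbrs v -> A n phi] =
    [set phi | forall c, c \in children v -> ball_event psi0 k c phi].
  apply/seteqP; split=> phi /= h x vx.
    by have := h x; rewrite mem_cat vx orbT /A vx; apply.
  by rewrite /A; case: ifP => // /h.
rewrite -AE prob_star; last first.
  move=> x _; rewrite /A; case: ifP => // vx.
  split; first exact: measurable_ball_event.
  by move=> phi phi' h; apply: ball_event_determined => y;
    rewrite -(comp_child y vx); apply: h.
congr (_ * _); rewrite big_cat /= big1_seq ?mul1r.
  apply: eq_big_seq => c vc; rewrite /A vc.
  have dc : odd (depth c) = ~~ odd (depth v) by rewrite (depth_child vc).
  have [sc|sc] := eqVneq (psi0 c).2 (~~ odd (depth c)).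
    rewrite prob_child_ball // IHk //.
    rewrite [X in trans _ _ X _]surjective_pairing sv.
    rewrite [X in trans _ _ _ X]surjective_pairing sc transE //.
    by rewrite mulrA divfK // mulrAC.
  (* The child is prescribed the sign of its parent: the event is empty, and the transition is zero
     because edges of 2H change sign. *)
  rewrite ball_event_wrong_sign // set0I prob0 mul0r /trans /dadj sv.
  have -> : (psi0 c).2 = ~~ odd (depth v).
    by move: sc; rewrite dc negbK; case: (psi0 c).2 (odd _) => [] [].
  by rewrite eqxx !mul0r.
move=> x; case E : (parent v) => [p|] //=; rewrite mem_seq1 => /eqP ->.
rewrite /A ifN ?setTI ?divff //; apply/negP => /depth_child.
by rewrite (depth_parent E) => /eqP; rewrite -[X in X == _]addn0 -addn2 eqn_add2l.
Qed.

End Simple.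
(** With [k] carrying [uv] to the root edge, the configurations [phi \o k], for [phi] in the
    root-edge event, are exactly those with the prescribed spins on [uv]. *)
Lemma prob_edge_invariant u v i j : semi_invariant mu ->
  ~~ odd (depth u) -> tadj u v ->
  prob (site_is v j `&` site_is u i) =
  prob (site_is (fst_child r) j `&` site_is Defs.root i).
Proof.
move=> mu_semi eu uv; have [k kaut [kpar ku kv]] := aut_to_root_edge eu uv.
set S := site_is (fst_child r) j `&` _.
have mS : measurable S by apply: measurableI; exact: measurable_site_is.
rewrite /prob -(mu_semi k kaut kpar _ mS); congr (fine (mu _)).
have [[k' kK k'K] _] := kaut.
apply/seteqP; split=> [phi [vj ui]|_ [phi [vj ui] <-]].
  exists (phi \o k'); last by apply/funext => x /=; rewrite kK.
  by split; rewrite /site_is /= -?kv -?ku kK.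
by split; rewrite /site_is /= ?kv ?ku.
Qed.

(** * The Gibbs condition at a single site *)

Section Gibbs.
Variables (adj : rel 'I_q.+1) (lam : 'I_q.+1 -> R).
Hypotheses (adj_sym : symmetric adj) (lam_pos : forall i, 0 < lam i).

(** The activities of the neighbours form a factor [C] common to all choices of the spin at [u],
    which cancels in the normalisation. *)
Lemma gibbs_kernel_site u i j (phi : hspace r q) : nbrs_are u j phi ->
  gibbs_kernel adj lam (U := [:: u]) [tuple i] phi =
  (adj i j)%:R * lam i / \sum_k (adj k j)%:R * lam k.
Proof.
move=> phij.
have uU : u \in Ubar [:: u] by rewrite mem_undup mem_head.
have UbarE x : x \in Ubar [:: u] -> x != u -> tadj u x.
  by rewrite mem_undup /= cats0 in_cons => /orP[->//|]; rewrite mem_nbrs.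
have extE (k : 'I_q.+1) x : ext [:: u] [:: k] phi x = if x == u then k else phi x.
  by rewrite /ext mem_seq1; case: eqVneq => [->|//]; rewrite /= eqxx.
have okE k : okU adj [:: u] [:: k] phi = adj k j.
  rewrite /okU; apply/idP/idP.
    move=> /allP/(_ _ uU)/allP.
    have [n nu] := nbrs_ex u.
    move/(_ n); rewrite mem_undup /= cats0 in_cons nu orbT => /(_ isT).
    by rewrite -mem_nbrs nu !extE eqxx (negbTE (nbrs_neq nu)) phij.
  move=> kj; apply/allP => x xU; apply/allP => y yU; apply/implyP => xy.
  (* Only pairs of [u] and a neighbour matter: two neighbours of [u] have equal parity, so they are
     not adjacent. *)
  rewrite !extE; case: (eqVneq x u) (eqVneq y u) => [xu|xu] [yu|yu].
  - by move/parity_adj: xy; rewrite xu yu; case: odd.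
  - by rewrite phij // mem_nbrs -xu.
  - by rewrite phij ?mem_nbrs ?UbarE // adj_sym.
  - by move/parity_adj: xy; rewrite (parity_adj (UbarE _ xU xu))
      (parity_adj (UbarE _ yU yu)); case: odd.
pose C := \prod_(x <- Ubar [:: u] | x != u) lam (phi x).
have C0 : C != 0 by apply: lt0r_neq0; apply: prodr_gt0.
have wE k : weightU adj lam [:: u] [:: k] phi = C * ((adj k j)%:R * lam k).
  rewrite /weightU okE (bigD1_seq u) ?undup_uniq //= extE eqxx.
  rewrite (eq_bigr (fun x => lam (phi x))); last first.
    by move=> x /negbTE xu; rewrite extE xu.
  by rewrite -/C [RHS]mulrC -mulrA.
rewrite /gibbs_kernel wE.
rewrite (reindex (fun k : 'I_q.+1 => [tuple k])) /=; last first.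
  exists (fun t : 1.-tuple _ => tnth t ord0) => [k _ //|t _].
  by apply: eq_from_tnth => l; rewrite (ord1 l).
rewrite (eq_bigr _ (fun k _ => wE k)) -mulr_sumr.
by rewrite invfM mulrACA divff // mul1r.
Qed.

(** The event on the neighbours depends only on sites other than [u], and the kernel is constant on
    it, so the Gibbs integral is a product. *)
Lemma gibbs_star u i j : is_gibbs adj lam mu ->
  prob (nbrs_are u j `&` site_is u i) =
  (adj i j)%:R * lam i / (\sum_k (adj k j)%:R * lam k) * prob (nbrs_are u j).
Proof.
move=> [_ mu_gibbs]; have mB := measurable_nbrs_are u j.
have dB : determined_by (fun v => v \notin [:: u]) (nbrs_are u j).
  by move=> phi phi' h H n nu; rewrite -h ?H // mem_seq1 nbrs_neq.
have := mu_gibbs [:: u] isT [tuple i] _ mB dB.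
rewrite (_ : [set phi | _] = site_is u i); last first.
  apply/seteqP; split=> phi /=.
    by move=> /(_ u (mem_head _ _)); rewrite /= eqxx.
  by move=> ui v; rewrite mem_seq1 => /eqP ->; rewrite /= eqxx.
rewrite (eq_integral (cst ((adj i j)%:R * lam i / \sum_k (adj k j)%:R * lam k)%:E)).
  rewrite integral_cst // setIC /prob => ->.
  by rewrite fineM ?fin_num_measure.
by move=> phi; rewrite inE => phij; rewrite (gibbs_kernel_site _ phij).
Qed.

End Gibbs.
End Law.

(** * Connectivity of the bipartite double *)

Section Connectivity.
Variables (V : finType) (adj : rel V).
Hypotheses (adj_sym : symmetric adj) (adj_conn : connected_graph adj).

Lemma connected_closed (X : {pred V}) i0 : i0 \in X ->
  (forall i j, adj i j -> i \in X -> j \in X) -> forall i, i \in X.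
Proof.
move=> Xi0 clX i; have cl := intro_closed (sym_connect_sym adj_sym) clX.
by rewrite -(closed_connect cl (adj_conn i0 i)).
Qed.

(** [X] and [Y] are the positive and negative parts of a set of nodes of 2H closed under adjacency,
    so this is the connectivity of 2H. Their union is everything; if they were disjoint, [X] would
    be a 2-colouring; so they meet, and their intersection is closed too. *)
Lemma nonbipartite_double_closed (X Y : {pred V}) i0 :
  ~ bipartite_graph adj -> i0 \in X ->
  (forall i j, adj i j -> i \in X -> j \in Y) ->
  (forall i j, adj i j -> i \in Y -> j \in X) ->
  (forall i, i \in X) /\ (forall i, i \in Y).
Proof.
move=> nonbip Xi0 XY YX.
have XorY i : (i \in X) || (i \in Y).
  apply: (@connected_closed [predU X & Y] i0); rewrite ?inE ?Xi0 // => k l kl.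
  by rewrite !inE => /orP[/(XY _ _ kl) ->|/(YX _ _ kl) ->]; rewrite ?orbT.
suff [k XYk] : exists k, (k \in X) && (k \in Y).
  have XYall i : i \in [predI X & Y].
    apply: (connected_closed XYk) => m l ml.
    by rewrite !inE => /andP[/(XY _ _ ml) -> /(YX _ _ ml) ->].
  by split=> i; have := XYall i; rewrite inE => /andP[].
apply: contrapT => noXY; apply: nonbip; exists (fun i => i \in X) => i j ij.
have disj k : k \in X -> k \in Y -> False.
  by move=> Xk Yk; apply: noXY; exists k; rewrite Xk Yk.
have [Xi|Xi] := boolP (i \in X).
  by apply/eqP => /esym Xj; apply: (disj j) => //; exact: XY Xi.
have Yi : i \in Y by have := XorY i; rewrite (negbTE Xi).
by rewrite (YX _ _ ij Yi).
Qed.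

(** For an isolated [i], the single node [+i] would be closed under adjacency in 2H. *)
Lemma nonbipartite_neighbor i : ~ bipartite_graph adj -> exists j, adj i j.
Proof.
move=> nonbip; apply: contrapT => isolated.
have [||_ /(_ i)] := @nonbipartite_double_closed (pred1 i) pred0 i nonbip (eqxx i);
  rewrite ?inE // => k l; rewrite !inE // => kl /eqP ki.
by case: isolated; exists l; rewrite -ki.
Qed.

End Connectivity.

Lemma powR_invn_expr (R : realType) (x : R) n : 0 <= x ->
  (x `^ (n.+1%:R)^-1) ^+ n.+1 = x.
Proof.
by move=> x0; rewrite -powR_mulrn ?powR_ge0 // -powRrM mulVf ?powRr1 //.
Qed.

(** * Factorisation of the edge law into node weights, and the walk they define *)

Section EdgeWeights.
Variables (R : realType) (q r : nat) (adj : rel 'I_q.+1) (E : 'I_q.+1 -> 'I_q.+1 -> R).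
Implicit Types i j k : 'I_q.+1.

Let a i := \sum_j E i j.
Let b j := \sum_i E i j.

Hypothesis adj_sym : symmetric adj.

(* [starE] and [starE'] are the Gibbs condition at an even and an odd site all
   of whose neighbours carry the same spin, the left side being computed by
   simplicity.  They force the support of E to be a union of components of the
   edges of 2H, hence all of them, and then E = w w' is an (r+1)-th root. *)
Lemma edge_law_weights (lam B B' : 'I_q.+1 -> R) :
  connected_graph adj -> ~ bipartite_graph adj ->
  (forall i, 0 < lam i) -> (forall i j, 0 <= E i j) -> \sum_i a i = 1 ->
  (forall i j, a i * (E i j / a i) ^+ r.+1 = (adj i j)%:R * lam i * B j) ->
  (forall i j, b j * (E i j / b j) ^+ r.+1 = (adj i j)%:R * lam j * B' i) ->
  exists w : dnode q -> R, (forall x, 0 < w x) /\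
    forall i j, E i j = (adj i j)%:R * w (i, true) * w (j, false).
Proof.
move=> conn nonbip lam_pos E_ge0 a1 starE starE'.
have a_ge0 i : 0 <= a i by apply: sumr_ge0.
have aE i j : 0 < E i j -> 0 < a i.
  move=> Eij; apply: lt_le_trans Eij _.
  by rewrite /a (bigD1 j) //= lerDl sumr_ge0.
have bE i j : 0 < E i j -> 0 < b j.
  move=> Eij; apply: lt_le_trans Eij _.
  by rewrite /b (bigD1 i) //= lerDl sumr_ge0.
have E_gt0 i j : (0 < E i j) = (E i j != 0) by rewrite lt_def E_ge0 andbT.
have adjE i j : 0 < E i j -> adj i j /\ 0 < B j.
  move=> Eij; have : 0 < (adj i j)%:R * lam i * B j.
    by rewrite -starE mulr_gt0 ?exprn_gt0 ?divr_gt0 ?(aE _ _ Eij).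
  case: (adj i j); last by rewrite !mul0r ltxx.
  by rewrite mul1r pmulr_rgt0.
have adjE' i j : 0 < E i j -> 0 < B' i.
  move=> Eij; have : 0 < (adj i j)%:R * lam j * B' i.
    by rewrite -starE' mulr_gt0 ?exprn_gt0 ?divr_gt0 ?(bE _ _ Eij).
  by rewrite (adjE _ _ Eij).1 mul1r pmulr_rgt0.
(* Positivity passes between edges with a common end: [E i j] forces [B j] to be positive, and then
   [E k j = 0] would contradict [starE k j]. *)
have spread i j k : 0 < E i j -> adj k j -> 0 < E k j.
  move=> /adjE[_ Bj] kj; rewrite E_gt0; apply: contraTneq isT => Ekj.
  have := starE k j; rewrite Ekj mul0r expr0n mulr0 kj mul1r => /esym/eqP.
  by rewrite gt_eqF // mulr_gt0.
have spread' i j k : 0 < E i j -> adj i k -> 0 < E i k.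
  move=> /adjE' Bi ik; rewrite E_gt0; apply: contraTneq isT => Eik.
  have := starE' i k; rewrite Eik mul0r expr0n mulr0 ik mul1r => /esym/eqP.
  by rewrite gt_eqF // mulr_gt0.
(* The spins that occur at even and at odd ends; they form a nonempty closed set of nodes of 2H. *)
pose X := [pred i | [exists j, 0 < E i j]].
pose Y := [pred j | [exists i, 0 < E i j]].
have [i0 Xi0] : exists i, i \in X.
  apply: contrapT => noX; have : \sum_i a i = 0.
    apply: big1 => i _; apply: big1 => j _; apply: contrapT => /eqP.
    by rewrite -E_gt0 => Eij; apply: noX; exists i; apply/existsP; exists j.
  by rewrite a1 => /eqP; rewrite oner_eq0.
have [allX allY] : (forall i, i \in X) /\ (forall j, j \in Y).
  apply: (nonbipartite_double_closed adj_sym conn nonbip Xi0).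
    move=> i k ik /existsP[j Eij]; apply/existsP; exists i.
    exact: spread' Eij ik.
  move=> j k jk /existsP[i Eij]; apply/existsP; exists j.
  by apply: spread Eij _; rewrite adj_sym.
have aP i : 0 < a i by case/existsP: (allX i) => j /aE.
have BP j : 0 < B j by case/existsP: (allY j) => i /adjE[].
have adj_gt0 i j : adj i j -> 0 < E i j.
  by move=> ij; case/existsP: (allX i) => k /spread'; apply.
(* Multiplied by [a i ^+ r], [starE] on an edge reads [E i j ^+ r.+1 = lam i * a i ^+ r * B j]; the
   weights are the roots of the two factors. *)
pose w (x : dnode q) :=
  (if x.2 then lam x.1 * a x.1 ^+ r else B x.1) `^ (r.+1%:R)^-1.
exists w; split=> [[i []]|i j]; first by rewrite powR_gt0 ?mulr_gt0 ?exprn_gt0.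
  by rewrite powR_gt0.
case ij : (adj i j); last first.
  rewrite !mul0r; apply: contrapT => /eqP; rewrite -E_gt0 => /adjE[].
  by rewrite ij.
rewrite mul1r; apply/eqP; rewrite -(eqrXn2 (n := r.+1)) ?mulr_ge0 ?powR_ge0 //.
rewrite exprMn !powR_invn_expr ?mulr_ge0 ?exprn_ge0 ?ltW //=.
have := starE i j; rewrite ij mul1r mulrAC => <-.
rewrite expr_div_n [X in _ / X]exprS mulrAC -mulrA; apply/eqP.
by field; rewrite expf_neq0 ?gt_eqF.
Qed.

Variable w : dnode q -> R.
Hypothesis w_pos : forall x, 0 < w x.
Hypothesis weightsE : forall i j, E i j = (adj i j)%:R * w (i, true) * w (j, false).

Lemma dnode_sum (P : pred (dnode q)) (F : dnode q -> R) :
  \sum_(x | P x) F x =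
  \sum_i ((if P (i, true) then F (i, true) else 0) +
          (if P (i, false) then F (i, false) else 0)).
Proof.
rewrite big_mkcond (eq_bigr (fun x => if P (x.1, x.2) then F (x.1, x.2) else 0)).
  2: by case.
rewrite -(pair_bigA _ (fun i s => if P (i, s) then F (i, s) else 0)) /=.
by apply: eq_bigr => i _; rewrite big_bool.
Qed.

(** Only negative nodes enter [zw] at a positive node, so the product is a row sum of [E]: the
    unnormalised stationary weight is the law of an even spin. *)
Lemma weight_zw_pos i : w (i, true) * zw adj w (i, true) = a i.
Proof.
rewrite /zw dnode_sum mulr_sumr; apply: eq_bigr => j _.
by rewrite weightsE /dadj /=; case: (adj i j); rewrite ?mul0r ?addr0 ?add0r ?mulr0 ?mul1r.
Qed.

Lemma weight_zw_neg j : w (j, false) * zw adj w (j, false) = b j.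
Proof.
rewrite /zw dnode_sum mulr_sumr; apply: eq_bigr => i _.
rewrite weightsE /dadj /= adj_sym.
by case: (adj i j); rewrite ?mul0r ?addr0 ?mulr0 ?mul1r // mulrC.
Qed.

Lemma zw_gt0 x : (forall i, exists j, adj i j) -> 0 < zw adj w x.
Proof.
move=> /(_ x.1)[j xj]; rewrite /zw (bigD1 (j, ~~ x.2)) /=.
  by apply: ltr_wpDr => //; apply: sumr_ge0 => y _; exact: ltW.
by rewrite /dadj /= xj andbT; case: x.2.
Qed.

(** Multiplying numerator and denominator by [w (i, true)] turns the step of the walk into the
    conditional law across an edge. *)
Lemma trans_pos i j : trans adj w (i, true) (j, false) = E i j / a i.
Proof.
rewrite /trans -weight_zw_pos weightsE /dadj /= invfM [X in _ = X * _]mulrAC.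
by rewrite -[RHS]mulrA mulVKf ?lt0r_neq0.
Qed.

Lemma trans_neg i j : trans adj w (j, false) (i, true) = E i j / b j.
Proof.
rewrite /trans -weight_zw_neg weightsE /dadj /= adj_sym invfM -[RHS]mulrA.
by rewrite mulVKf ?lt0r_neq0.
Qed.

Lemma root_law_pos i : \sum_i a i = 1 -> root_law adj w (i, true) = a i.
Proof.
move=> a1; rewrite /root_law /= weight_zw_pos dnode_sum /=.
rewrite (eq_bigr a); first by rewrite a1 divr1.
by move=> k _; rewrite weight_zw_pos addr0.
Qed.

End EdgeWeights.

(** * Measurability of the lift *)

Section LiftLaw.
Variables (r q : nat).

Lemma measurable_parity_lift :
  measurable_fun setT (@parity_lift r q : hspace r q -> dspace r q).
Proof.
apply: (@measurability _ _ (hspace r q) (dspace r q) _ _ cylinders) => //.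
move=> _ [_ [v [x ->]] <-].
by rewrite setTI; exact: measurable_lift_site.
Qed.

HB.instance Definition _ :=
  isMeasurableFun.Build _ _ _ _ (@parity_lift r q) measurable_parity_lift.

End LiftLaw.

(** * The edge law of [mu] and its weights *)

Section Conclusion.
Variables (R : realType) (r q : nat) (mu : probability (hspace r q) R).
Variables (adj : rel 'I_q.+1) (lam : 'I_q.+1 -> R).
Hypotheses (adj_sym : symmetric adj) (H_conn : connected_graph adj).
Hypotheses (H_nonbip : ~ bipartite_graph adj) (lam_pos : forall i, 0 < lam i).
Hypotheses (mu_gibbs : is_gibbs adj lam mu) (mu_semi : semi_invariant mu).
Hypothesis mu_simple : simple_measure mu.

(** Read off at one reference edge; [i] always belongs to the even end and [j] to the odd end. *)
Let E i j := prob mu (site_is (fst_child r) j `&` site_is Defs.root i).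
Let a i := \sum_j E i j.
Let b j := \sum_i E i j.

Lemma prob_edge_even u v i j : ~~ odd (depth u) -> tadj u v ->
  prob mu (site_is v j `&` site_is u i) = E i j.
Proof. exact: prob_edge_invariant. Qed.

Lemma prob_edge_odd u v i j : odd (depth u) -> tadj u v ->
  prob mu (site_is v i `&` site_is u j) = E i j.
Proof.
move=> ou uv; rewrite setIC; apply: prob_edge_even; last by rewrite tadj_sym.
by rewrite (parity_adj uv) ou.
Qed.

Lemma prob_site_even u i : ~~ odd (depth u) -> prob mu (site_is u i) = a i.
Proof.
move=> eu; have [n nu] := nbrs_ex u.
rewrite (prob_marginal mu n (measurable_site_is u i)).
by apply: eq_bigr => j _; rewrite prob_edge_even // -mem_nbrs.
Qed.

Lemma prob_site_odd u j : odd (depth u) -> prob mu (site_is u j) = b j.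
Proof.
move=> ou; have [n nu] := nbrs_ex u.
rewrite (prob_marginal mu n (measurable_site_is u j)).
by apply: eq_bigr => i _; rewrite prob_edge_odd // -mem_nbrs.
Qed.

(** By simplicity the [r.+1] neighbours are independent given the spin at [u], here with equal
    conditional probabilities of spin [j]. *)
Lemma prob_nbrs_are u i j (e : R) :
  (forall n, tadj u n -> prob mu (site_is n j `&` site_is u i) = e) ->
  prob mu (nbrs_are u j `&` site_is u i) =
  prob mu (site_is u i) * (e / prob mu (site_is u i)) ^+ r.+1.
Proof.
move=> he; rewrite [nbrs_are u j](_ : _ =
  [set phi | forall n, n \in nbrs u -> site_is n j phi]) //.
rewrite prob_star //; last first.
  move=> n nu; split; first exact: measurable_site_is.
  by apply: site_is_determined; exact: comp_nbr.
congr (_ * _); rewrite (eq_big_seq (fun=> e / prob mu (site_is u i))).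
  by rewrite big_const_seq count_predT size_nbrs iter_mulr_1.
by move=> n; rewrite mem_nbrs => /he ->.
Qed.

Lemma edge_weights_exist : exists w : dnode q -> R, (forall x, 0 < w x) /\
  forall i j, E i j = (adj i j)%:R * w (i, true) * w (j, false).
Proof.
(* [Z] is the one-site normalisation and [B] the part of the Gibbs identity that does not involve
   the spin at [u]; the root serves for even sites, [fst_child] for odd ones. *)
pose Z j := \sum_k (adj k j)%:R * lam k.
pose B u j := prob mu (nbrs_are u j) / Z j.
apply: (@edge_law_weights _ _ r _ _ adj_sym lam (B Defs.root) (B (fst_child r))) => //.
- by move=> i j; exact: prob_ge0.
- have <- : prob mu setT = 1 by exact: probT.
  rewrite (prob_marginal mu Defs.root (@measurableT _ (hspace r q))).
  by apply: eq_bigr => i _; rewrite setIT prob_site_even.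
- move=> i j; have := gibbs_star adj_sym lam_pos Defs.root i j mu_gibbs.
  rewrite (prob_nbrs_are (e := E i j)) ?prob_site_even // => [->|n un].
    by rewrite -/(Z j) mulrAC -mulrA.
  exact: prob_edge_even.
- move=> i j; have := gibbs_star adj_sym lam_pos (fst_child r) j i mu_gibbs.
  rewrite (prob_nbrs_are (e := E i j)) ?prob_site_odd // => [->|n un].
    by rewrite -/(Z i) mulrAC -mulrA adj_sym.
  exact: prob_edge_odd.
Qed.

End Conclusion.

(** * The lift of [mu] as the walk on 2H *)

Theorem theorem9p1 (R : realType) (q r : nat) (adj : rel 'I_q.+1)
    (adj_sym : symmetric adj)
    (H_conn : connected_graph adj) (H_nonbip : ~ bipartite_graph adj)
    (r_pos : (0 < r)%N)
    (lam : 'I_q.+1 -> R) (lam_pos : forall i, 0 < lam i)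
    (mu : probability (hspace r q) R)
    (mu_gibbs : is_gibbs adj lam mu)
    (mu_semi : semi_invariant mu)
    (mu_simple : simple_measure mu) :
  exists w : dnode q -> R, (forall a, 0 < w a) /\
    exists P : probability (dspace r q) R,
      walk_law adj w P /\
      forall A : set (hspace r q), measurable A ->
        mu A = P (@absmap r q @^-1` A).
Proof.
have [w [w_pos wE]] := edge_weights_exist adj_sym H_conn H_nonbip lam_pos
  mu_gibbs mu_semi mu_simple.
(* The law of the lift: forgetting the signs recovers the configuration, so the second claim holds
   by computation. *)
exists w; split=> //; exists (distribution mu (@parity_lift r q)); split; last first.
  by move=> A _; rewrite /distribution /pushforward.
have a1 : \sum_i prob mu (site_is Defs.root i) = 1.
  rewrite -(probT mu) (prob_marginal mu Defs.root (@measurableT _ (hspace r q))).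
  by apply: eq_bigr => i _; rewrite setIT.
have z_pos x : 0 < zw adj w x.
  by apply: zw_gt0 => // i; exact: nonbipartite_neighbor.
(* Each such probability is [w x * zw adj w x] at the node of 2H with the sign of the site. *)
have prob_pos u i : 0 < prob mu (site_is u i).
  have [ou|eu] := boolP (odd (depth u)).
    by rewrite (prob_site_odd mu_semi) // -(weight_zw_neg adj_sym wE) mulr_gt0.
  by rewrite (prob_site_even mu_semi) // -(weight_zw_pos wE) mulr_gt0.
have transE u c i j : c \in children u ->
    trans adj w (i, ~~ odd (depth u)) (j, ~~ odd (depth c)) =
    prob mu (site_is c j `&` site_is u i) / prob mu (site_is u i).
  move=> uc; have adj_uc : tadj u c by rewrite /tadj !parent_children uc.
  rewrite (parity_adj adj_uc); have [ou|eu] := boolP (odd (depth u)) => /=.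
    by rewrite (trans_neg adj_sym w_pos wE) (prob_edge_odd mu_semi j i ou adj_uc)
      (prob_site_odd mu_semi i ou).
  by rewrite (trans_pos w_pos wE) (prob_edge_even mu_semi i j eu adj_uc)
    (prob_site_even mu_semi i eu).
move=> n psi0; rewrite /distribution /pushforward.
(* Every site descends from the root, so the ball there is the whole cylinder of depth [n]. *)
transitivity (mu (ball_event psi0 n Defs.root)); first congr (mu _).
  apply/seteqP; split=> phi /=.
    by move=> h; apply/ball_eventP => x _; rewrite addn0 => /h.
  by move=> /ball_eventP h x xn; apply: h; rewrite ?desc_root ?addn0.
(* With a negative root spin both sides vanish: no lift has one, and [root_law] is zero there. *)
case: (boolP (psi0 Defs.root).2) => [sr|sr]; last first.
  rewrite ball_event_wrong_sign //; last by rewrite (negbTE sr).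
  by rewrite measure0 /root_law (negbTE sr) mul0r.
rewrite (probE mu (measurable_ball_event _ _ _)).
rewrite (prob_ball mu_simple prob_pos _ transE) //.
congr (_ * _)%:E; rewrite [psi0 _ in RHS]surjective_pairing sr.
rewrite (root_law_pos wE) ?prob_site_even // -[RHS]a1.
by apply: eq_bigr => i _; rewrite prob_site_even.
Qed.
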